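(* Let $\Pi\subseteq\mathfrak S_n$ form an allowable graph of permutations. Then $\mathcal T_\Pi=\{X^\sigma:\sigma\in\Pi\}\subseteq\{+,-,0\}^{\binom{[n]}{2}}$ is the set of topes of an acycloid.
   Context: Permutations $\sigma\in\mathfrak S_n$ are viewed as words $[\sigma(1),\dots,\sigma(n)]$; a substring is a contiguous subword. A move is a set of one or more pairwise disjoint substrings (of length at least $2$); it is applied to $\sigma$ by reversing each of these substrings, giving a permutation $\gamma$. Its inversion set $\mathrm{Inv}_m$ is the set of pairs $(i,j)$, $i<j$, of letters lying in a common substring of $m$ (equivalently $\mathrm{inv}(\sigma)\triangle\mathrm{inv}(\gamma)$, where $\mathrm{inv}(\sigma)$ is the set of pairs of letters $i<j$ with $j$ before $i$ in $\sigma$). An allowable sequence in $\Pi$ from $\sigma$ to $\sigma'$ is a sequence $\sigma=\sigma_0,\dots,\sigma_l=\sigma'$ of elements of $\Pi$ where each $\sigma_k$ is obtained from $\sigma_{k-1}$ by a move $m_k$, and each pair of letters is reversed at most once (the sets $\mathrm{Inv}_{m_k}$ are pairwise disjoint). The reverse $\bar\sigma$ is given by $\bar\sigma(t)=\sigma(n-t+1)$. A set $\Pi\subseteq\mathfrak S_n$ forms an allowable graph of permutations if there is a set $\mathcal M$ of moves with: (P1) $\sigma\in\Pi\Rightarrow\bar\sigma\in\Pi$; (P2) any $\sigma,\sigma'\in\Pi$ are joined by an allowable sequence in $\Pi$ whose moves lie in $\mathcal M$; (P3) for $m,s\in\mathcal M$, either $\mathrm{Inv}_m=\mathrm{Inv}_s$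 or $\mathrm{Inv}_m\cap\mathrm{Inv}_s=\emptyset$. $\binom{[n]}{2}$ is the set of pairs $(i,j)$, $i<j$; $X^\sigma_{(i,j)}=+$ if $i$ appears before $j$ in $\sigma$ and $-$ otherwise. For sign vectors: $S(X,Y)=\{e:\{X_e,Y_e\}=\{+,-\}\}$; the support is $\{e: X_e\ne0\}$; for a set $\mathcal T$ of sign vectors, the parallelism class $[e]$ of $e$ is the set of $f$ with $X_f=X_e$ for all $X\in\mathcal T$ or $X_f=-X_e$ for all $X\in\mathcal T$; ${}_{-F}X$ negates the entries of $X$ in $F$. A set $\mathcal T\subseteq\{+,-,0\}^E$ is the set of topes of an acycloid if: (T1) all elements of $\mathcal T$ have the same support; (T2) $X\in\mathcal T\Rightarrow -X\in\mathcal T$; (T3) if $X\ne Y\in\mathcal T$ there is $f\in S(X,Y)$ with ${}_{-[f]}X\in\mathcal T$. *)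

(* Defs.v *)
From HB Require Import structures.
From mathcomp Require Import all_boot all_fingroup.

Set Implicit Arguments.
Unset Strict Implicit.
Unset Printing Implicit Defensive.

Inductive sign := Pos | Neg | Zero.

Definition sign_to_ord (x : sign) : 'I_3 :=
  match x with Pos => inord 0 | Neg => inord 1 | Zero => inord 2 end.

Definition ord_to_sign (i : 'I_3) : sign :=
  match val i with 0 => Pos | 1 => Neg | _ => Zero end.

Lemma sign_to_ordK : cancel sign_to_ord ord_to_sign.
Proof. by case; rewrite /ord_to_sign /= inordK. Qed.

HB.instance Definition _ := Finite.copy sign (can_type sign_to_ordK).

Definition sopp (x : sign) : sign :=
  match x with Pos => Neg | Neg => Pos | Zero => Zero end.

Section SignVectors.
Variable E : finType.

Definition signvec := {ffun E -> sign}.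

Implicit Types (X Y : signvec) (T : {set signvec}) (F : {set E}) (e f : E).

Definition vopp X : signvec := [ffun e => sopp (X e)].

Definition reorient F X : signvec :=
  [ffun e => if e \in F then sopp (X e) else X e].

Definition vsupport X : {set E} := [set e | X e != Zero].

Definition separation X Y : {set E} :=
  [set e | [set X e; Y e] == [set Pos; Neg]].

Definition parallel_class T e : {set E} :=
  [set f | [forall X in T, X f == X e] || [forall X in T, X f == sopp (X e)]].

Definition acycloid_topes T : Prop :=
  [/\ {in T &, forall X Y, vsupport X = vsupport Y},
      {in T, forall X, vopp X \in T}
    & {in T &, forall X Y, X <> Y ->
        exists2 f, f \in separation X Y
                 & reorient (parallel_class T f) X \in T}].

End SignVectors.

(** Positions and letters are numbered [0, .., n-1] instead of [1, .., n]. *)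

Section Permutations.
Variable n : nat.

Implicit Types (s g : 'S_n) (Pi : {set 'S_n}).

Definition perm_word s : seq 'I_n := [seq s i | i <- enum 'I_n].

Definition perm_reverse s : 'S_n := (perm (@rev_ord_inj n) * s)%g.

Definition lpair := {e : 'I_n * 'I_n | e.1 < e.2}.

(** A word without repeated letters has length at most [n], so that the finite
    type of words of length at most [n] contains every substring of a
    permutation. *)
Definition move := {set n.-bseq 'I_n}.

Implicit Types (m : move) (M : {set move}).

(** Words with distinct letters and pairwise disjoint letter sets are exactly
    the families of pairwise disjoint substrings of some permutation; that they
    are substrings of the permutation being moved is part of [move_applies]. *)
Definition is_move m : Prop :=
  [/\ m != set0,
      {in m, forall w : n.-bseq 'I_n, uniq w /\ 2 <= size w}
    & {in m &, forall w1 w2 : n.-bseq 'I_n, w1 != w2 -> [disjoint w1 & w2]}].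

(** [s] is cut into consecutive blocks, among which are all the substrings of
    [m]; [g] is obtained by reversing the latter and keeping the others. *)
Definition move_applies m s g : Prop :=
  exists bs : seq (n.-bseq 'I_n),
    [/\ perm_word s = flatten [seq (b : seq 'I_n) | b : n.-bseq 'I_n <- bs],
        {subset m <= bs}
      & perm_word g =
        flatten [seq (if b \in m then rev b else b) | b : n.-bseq 'I_n <- bs]].

Definition Inv m : {set lpair} :=
  [set e : lpair |
    [exists w in m, ((val e).1 \in w) && ((val e).2 \in w)]].

(** [ms k] leads from [gs k] to [gs k.+1]; the values [gs k] for [k > l] and
    [ms k] for [k >= l] are irrelevant. *)
Definition allowable_sequence Pi s s' (l : nat)
    (gs : nat -> 'S_n) (ms : nat -> move) : Prop :=
  [/\ gs 0 = s /\ gs l = s',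
      forall k, k <= l -> gs k \in Pi,
      forall k, k < l -> is_move (ms k) /\ move_applies (ms k) (gs k) (gs k.+1)
    & forall j k, j < k -> k < l -> [disjoint Inv (ms j) & Inv (ms k)]].

Definition allowable_graph Pi : Prop :=
  exists M : {set move},
    [/\ {in M, forall m, is_move m},
        {in Pi, forall s, perm_reverse s \in Pi},
        {in Pi &, forall s s', exists l gs ms,
           allowable_sequence Pi s s' l gs ms
           /\ forall k, k < l -> ms k \in M}
      & {in M &, forall m1 m2,
           Inv m1 = Inv m2 \/ Inv m1 :&: Inv m2 = set0}].

Definition perm_signvec s : signvec lpair :=
  [ffun e : lpair =>
    if (s^-1)%g (val e).1 < (s^-1)%g (val e).2 then Pos else Neg].

Definition perm_topes Pi : {set signvec lpair} :=
  [set perm_signvec s | s in Pi].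

End Permutations.

(* Main.v *)
Require Import Defs.
From mathcomp Require Import all_boot all_fingroup.
From mathcomp Require Import zify.

Set Implicit Arguments.
Unset Strict Implicit.
Unset Printing Implicit Defensive.

(** Applying a move negates exactly the entries of [X^s] indexed by its
    inversion set. Given [s <> s'], let [m] be the first move of an allowable
    sequence from [s] to [s'] and let [f] be in [Inv m]. As [f] is reversed only
    once, it separates [X^s] from [X^s'], so it suffices that [Inv m] is the
    parallelism class of [f]. An element parallel to [f] must change sign under
    [m], hence lies in [Inv m]; conversely every tope is reached from [s] by
    moves whose inversion sets, by (P3), contain both [f] and a given element of
    [Inv m] or neither of them. *)

Lemma soppK : involutive sopp.
Proof. by case. Qed.

Lemma index_rev_uniq (T : eqType) (w : seq T) (x : T) :
  uniq w -> x \in w -> index x (rev w) = size w - (index x w).+1.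
Proof.
move=> w_uniq xw; have ltxw : index x w < size w by rewrite index_mem.
have lt_sub : size w - (index x w).+1 < size w by lia.
rewrite -[in LHS](nth_index x xw).
have -> : nth x w (index x w) = nth x (rev w) (size w - (index x w).+1).
  by rewrite nth_rev //; congr (nth x w _); lia.
by rewrite index_uniq ?size_rev ?rev_uniq.
Qed.

(** Reversing a block changes neither its letters nor its size, so letters of different blocks keep
    their order, and two letters of one block swap exactly when it is reversed. Uniqueness puts each
    letter in a single block, hence [has] counts at most one reversal. *)
Lemma index_flatten_rev (I : Type) (T : eqType) (h : I -> seq T) (P : pred I)
    (bs : seq I) (x y : T) :
  uniq (flatten (map h bs)) -> x != y ->
  x \in flatten (map h bs) -> y \in flatten (map h bs) ->
  let w := flatten [seq (if P b then rev (h b) else h b) | b <- bs] in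
  (index x w < index y w) =
  (index x (flatten (map h bs)) < index y (flatten (map h bs)))
    (+) has (fun b => [&& P b, x \in h b & y \in h b]) bs.
Proof.
move=> + neq_xy; elim: bs => [|b bs IH] //=.
rewrite cat_uniq => /and3P [b_uniq /hasPn disj rest_uniq].
have not_in_rest z : z \in h b -> z \notin flatten (map h bs).
  by move=> zb; apply/negP => /disj; rewrite /= zb.
(* A letter of the head block occurs in no later block, so no later reversal can affect a pair
   containing it. *)
have no_has z1 z2 : z1 \in h b \/ z2 \in h b ->
    has (fun b => [&& P b, z1 \in h b & z2 \in h b]) bs = false.
  move=> zb; apply/negP => hasP'.
  have [z1r z2r] : z1 \in flatten (map h bs) /\ z2 \in flatten (map h bs).
    elim: bs hasP' {IH disj rest_uniq not_in_rest} => //= c bs IH.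
    rewrite !mem_cat => /orP [/and3P [_ -> ->] // | /IH [-> ->]].
    by rewrite !orbT.
  by case: zb => /not_in_rest; rewrite ?z1r ?z2r.
set b' := if P b then _ else _.
have mem_b' z : (z \in b') = (z \in h b).
  by rewrite /b'; case: (P b); rewrite ?mem_rev.
have size_b' : size b' = size (h b).
  by rewrite /b'; case: (P b); rewrite ?size_rev.
rewrite !mem_cat !index_cat !mem_b' size_b'.
have idx z : z \in h b -> index z (h b) < size (h b) by rewrite index_mem.
have idx' z : z \in h b -> index z b' < size (h b).
  by rewrite -size_b' index_mem mem_b'.
have [xb|xNb] := boolP (x \in h b); have [yb|yNb] := boolP (y \in h b) => /=.
- move=> _ _; rewrite no_has; last by left.
  rewrite /b' !andbT orbF; case: (P b); last by rewrite addbF.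
  rewrite !index_rev_uniq //.
  have : index x (h b) != index y (h b).
    by apply: contraNneq neq_xy => /(congr1 (nth x (h b))); rewrite !nth_index // => ->.
  by have := idx _ xb; have := idx _ yb; rewrite addbT; lia.
- move=> _ _; rewrite no_has ?andbF; last by left.
  by have := idx _ xb; have := idx' _ xb; rewrite addbF; lia.
- move=> _ _; rewrite no_has ?andbF; last by right.
  by have := idx _ yb; have := idx' _ yb; rewrite addbF; lia.
- move=> xr yr; rewrite !ltn_add2l andbF; exact: IH.
Qed.

Section PermutationTopes.
Variable n : nat.
Implicit Types (s g : 'S_n) (m : move n) (e f : lpair n).

Lemma lpair_neq e : (val e).1 != (val e).2.
Proof. by case: e => [[i j] /= ltij]; rewrite neq_ltn ltij. Qed.

Lemma mem_perm_word s i : i \in perm_word s.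
Proof. by apply/mapP; exists ((s^-1)%g i); rewrite ?mem_enum ?permKV. Qed.

Lemma perm_word_uniq s : uniq (perm_word s).
Proof. by rewrite map_inj_uniq ?enum_uniq //; apply: perm_inj. Qed.

Lemma index_perm_word s i : index i (perm_word s) = (s^-1)%g i.
Proof.
rewrite -[in LHS](permKV s i) /perm_word index_map; last exact: perm_inj.
by rewrite index_enum_ord.
Qed.

Lemma perm_signvecE s e :
  perm_signvec s e =
  if index (val e).1 (perm_word s) < index (val e).2 (perm_word s)
  then Pos else Neg.
Proof. by rewrite ffunE !index_perm_word. Qed.

Lemma perm_signvec_neq0 s e : perm_signvec s e != Zero.
Proof. by apply/eqP; rewrite ffunE; case: ifP. Qed.

Lemma perm_signvec_sopp_neq s e : perm_signvec s e <> sopp (perm_signvec s e).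
Proof. by rewrite ffunE; case: ifP. Qed.

(** Reversal sends the position of each letter to its mirror image; the two positions of a pair are
    distinct, so their comparison flips strictly. *)
Lemma perm_signvec_reverse s :
  perm_signvec (perm_reverse s) = vopp (perm_signvec s).
Proof.
apply/ffunP => e; rewrite !ffunE.
have revV i : ((perm_reverse s)^-1)%g i = rev_ord ((s^-1)%g i).
  apply: (@perm_inj _ (perm_reverse s)).
  by rewrite permKV permM permE rev_ordK permKV.
rewrite !revV /=.
have : (s^-1)%g (val e).1 != (s^-1)%g (val e).2.
  by rewrite (inj_eq perm_inj) lpair_neq.
rewrite -val_eqE /=.
have := ltn_ord ((s^-1)%g (val e).1); have := ltn_ord ((s^-1)%g (val e).2).
by do 2!case: ifP => //=; lia.
Qed.

Lemma perm_signvec_move m s g : move_applies m s g ->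
  perm_signvec g = reorient (Inv m) (perm_signvec s).
Proof.
move=> [bs [sE m_bs gE]]; apply/ffunP => e; rewrite [RHS]ffunE !perm_signvecE gE.
have := perm_word_uniq s.
have := mem_perm_word s (val e).1; have := mem_perm_word s (val e).2.
rewrite sE => e2 e1 bs_uniq.
rewrite (@index_flatten_rev _ _ _ (fun b => b \in m)) ?lpair_neq //.
(* [has] ranges over all blocks and [Inv m] over the substrings of [m]; they agree because [m_bs]
   makes every substring of [m] a block. *)
have -> : has (fun b : n.-bseq 'I_n =>
    [&& b \in m, (val e).1 \in (b : seq _) & (val e).2 \in (b : seq _)]) bs
    = (e \in Inv m).
  rewrite inE; apply/hasP/existsP => [[b _ /and3P [bm b1 b2]]|[b]].
    by exists b; rewrite bm b1.
  by move=> /and3P [bm b1 b2]; exists b; rewrite ?m_bs ?bm ?b1.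
by case: (e \in Inv m); case: (index _ _ < index _ _).
Qed.

(** The first two letters of any substring of [m], sorted by value, form such a pair. *)
Lemma Inv_neq0 m : is_move m -> exists f, f \in Inv m.
Proof.
move=> [/set0Pn [w wm] /(_ w wm) [w_uniq w_size] _].
have [x [y [neq_xy xw yw]]] : exists x y,
    [/\ x != y, x \in (w : seq _) & y \in (w : seq _)].
  case: w {wm} w_uniq w_size => -[|x [|y w]] //= ? /andP [+ _] _.
  rewrite inE negb_or => /andP [neq_xy _].
  by exists x, y; rewrite neq_xy !inE !eqxx orbT.
have [ltxy|ltyx|/val_inj eqxy] := ltngtP x y; last by rewrite eqxy eqxx in neq_xy.
- exists (exist (fun e : 'I_n * 'I_n => e.1 < e.2) (x, y) ltxy).
  by rewrite inE; apply/existsP; exists w; rewrite wm /= xw.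
- exists (exist (fun e : 'I_n * 'I_n => e.1 < e.2) (y, x) ltyx).
  by rewrite inE; apply/existsP; exists w; rewrite wm /= yw.
Qed.

End PermutationTopes.

Section AllowableSequence.
Variables (n : nat) (Pi : {set 'S_n}) (s s' : 'S_n) (l : nat).
Variables (gs : nat -> 'S_n) (ms : nat -> move n).
Hypothesis seqP : allowable_sequence Pi s s' l gs ms.

Lemma perm_signvec_step k e : k < l ->
  perm_signvec (gs k.+1) e =
  if e \in Inv (ms k) then sopp (perm_signvec (gs k) e)
  else perm_signvec (gs k) e.
Proof.
by case: seqP => _ _ stepP _ /stepP [_ /perm_signvec_move ->]; rewrite ffunE.
Qed.

Lemma perm_signvec_first f : 0 < l -> f \in Inv (ms 0) ->
  perm_signvec s' f = sopp (perm_signvec s f).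
Proof.
case: (seqP) => -[g0 gl] _ _ disj l_gt0 f0.
(* The indices start at 1: the base case is the first move, which flips [f], and later moves miss
   [f] by disjointness. *)
suff H k : k < l -> perm_signvec (gs k.+1) f = sopp (perm_signvec s f).
  by rewrite -gl -(prednK l_gt0) H ?prednK.
elim: k => [|k IH] ltkl; rewrite perm_signvec_step //.
  by rewrite f0 g0.
by rewrite (disjointFr (disj 0 k.+1 isT ltkl) f0) IH // ltnW.
Qed.

Lemma perm_signvec_parallel e f :
  (forall k, k < l -> (e \in Inv (ms k)) = (f \in Inv (ms k))) ->
  perm_signvec s' e = perm_signvec s e /\ perm_signvec s' f = perm_signvec s f
  \/ perm_signvec s' e = sopp (perm_signvec s e)
     /\ perm_signvec s' f = sopp (perm_signvec s f).
Proof.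
case: (seqP) => -[g0 gl] _ _ _ ef; rewrite -{}gl.
(* The induction is on the number of moves made, while the upper bound stays at [l] so that [ef]
   applies at each step. *)
have := leqnn l; elim: {1 3 4 5 6}l => [|k IH] ltkl; first by left; rewrite g0.
rewrite !perm_signvec_step // ef //.
case: (IH (ltnW ltkl)) => -[-> ->]; case: (f \in Inv (ms k)); rewrite ?soppK; tauto.
Qed.

End AllowableSequence.

Lemma parallel_class_Inv n (Pi : {set 'S_n}) (M : {set move n}) s g m f :
  {in Pi &, forall s1 s2, exists l gs ms,
     allowable_sequence Pi s1 s2 l gs ms /\ forall k, k < l -> ms k \in M} ->
  {in M &, forall m1 m2, Inv m1 = Inv m2 \/ Inv m1 :&: Inv m2 = set0} ->
  s \in Pi -> g \in Pi -> m \in M -> move_applies m s g -> f \in Inv m ->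
  parallel_class (perm_topes Pi) f = Inv m.
Proof.
move=> connP invP sPi gPi mM mP fm; apply/setP => e; rewrite inE.
have topeP t : t \in Pi -> perm_signvec t \in perm_topes Pi by apply: imset_f.
apply/idP/idP => [|em].
  have gE e' : perm_signvec g e' =
      if e' \in Inv m then sopp (perm_signvec s e') else perm_signvec s e'.
    by rewrite (perm_signvec_move mP) ffunE.
  (* From [s] to [g] the sign of [f] flips and that of [e] does not, so either kind of parallelism
     would make a sign equal to its opposite. *)
  case/orP => /'forall_implyP par; apply/negPn/negP => eNm;
    have /eqP := par _ (topeP _ gPi); have /eqP := par _ (topeP _ sPi);
    rewrite !gE fm (negPf eNm) => ->; rewrite ?soppK.
    exact: perm_signvec_sopp_neq.
  by move/esym; apply: perm_signvec_sopp_neq.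
have flip t : t \in Pi ->
    perm_signvec t e = perm_signvec s e /\ perm_signvec t f = perm_signvec s f
    \/ perm_signvec t e = sopp (perm_signvec s e)
       /\ perm_signvec t f = sopp (perm_signvec s f).
  move=> tPi; have [l [gs [ms [seqP msM]]]] := connP s t sPi tPi.
  apply: (perm_signvec_parallel seqP) => k /msM kM.
  (* Each move of the path has the inversion set of [m], containing both [e] and [f], or one
     disjoint from it, containing neither. *)
  have [-> | /setP inv0] := invP _ _ kM mM; first by rewrite em fm.
  by have := inv0 e; have := inv0 f; rewrite !in_setI !in_set0 em fm !andbT => -> ->.
(* By [flip], whether the signs of [e] and [f] agree or are opposite is the same at every tope as at
   [s]. *)
have [eq_ef|neq_ef] := eqVneq (perm_signvec s e) (perm_signvec s f).
  apply/orP; left; apply/'forall_implyP => _ /imsetP [t tPi ->].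
  by case: (flip t tPi) => -[-> ->]; rewrite eq_ef.
have opp_ef : perm_signvec s e = sopp (perm_signvec s f).
  move: neq_ef (perm_signvec_neq0 s e) (perm_signvec_neq0 s f).
  move=> /eqP + /eqP + /eqP.
  by case: (perm_signvec s e); case: (perm_signvec s f).
apply/orP; right; apply/'forall_implyP => _ /imsetP [t tPi ->].
by case: (flip t tPi) => -[-> ->]; rewrite opp_ef.
Qed.

Theorem theorem7p13 (n : nat) (Pi : {set 'S_n}) :
  allowable_graph Pi -> acycloid_topes (perm_topes Pi).
Proof.
move=> [M [_ revP connP invP]]; split.
- move=> _ _ /imsetP [s _ ->] /imsetP [t _ ->].
  by apply/setP => e; rewrite !inE !perm_signvec_neq0.
- move=> _ /imsetP [s sPi ->]; rewrite -perm_signvec_reverse.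
  by apply: imset_f; apply: revP.
move=> _ _ /imsetP [s sPi ->] /imsetP [t tPi ->] neq_st.
have [l [gs [ms [seqP msM]]]] := connP s t sPi tPi.
have [[g0 gl] gsPi stepP _] := seqP.
have l_gt0 : 0 < l.
  by case: l gl {seqP msM gsPi stepP} => // gl; case: neq_st; rewrite -g0 -gl.
have [move0 app0] := stepP 0 l_gt0; rewrite g0 in app0.
have [f f0] := Inv_neq0 move0.
exists f.
  rewrite inE (perm_signvec_first seqP l_gt0 f0).
  have /eqP := perm_signvec_neq0 s f.
  by case: (perm_signvec s f) => //=; rewrite setUC.
(* Negating the class of [f] thus performs the first move, and the resulting tope is that of
   [gs 1]. *)
rewrite (parallel_class_Inv connP invP sPi (gsPi 1 l_gt0)
  (msM 0 l_gt0) app0 f0) -(perm_signvec_move app0).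
by apply: imset_f; apply: gsPi.
Qed.
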